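(* For $m\geq 0$ let $M_m=\sum_{k=0}^{m}\frac{1}{k+1}\binom{m}{2k}\binom{2k}{k}$ denote the $m$-th Motzkin number. Then for all integers $n\geq 1$, $$\operatorname{Pf}\big((j-i)M_{i+j-3}\big)_{1\leq i,j\leq 2n}=\prod_{k=0}^{n-1}(4k+1).$$
   Context: For a $2n\times 2n$ skew-symmetric matrix $A=(a_{i,j})_{1\le i,j\le 2n}$ over a commutative ring (i.e. $a_{j,i}=-a_{i,j}$ and zero diagonal), the Pfaffian is $$\operatorname{Pf}(A)=\sum \epsilon(\sigma_1,\sigma_2,\dots,\sigma_{2n-1},\sigma_{2n})\,a_{\sigma_1\sigma_2}\cdots a_{\sigma_{2n-1}\sigma_{2n}},$$ where the sum is over all partitions $\{\{\sigma_1,\sigma_2\},\dots,\{\sigma_{2n-1},\sigma_{2n}\}\}$ of $\{1,\dots,2n\}$ into two-element subsets, and $\epsilon(\sigma_1,\dots,\sigma_{2n})$ is the sign of the permutation $i\mapsto\sigma_i$ (each summand is independent of the order of the blocks and of the elements within each block). The diagonal entries of the matrix in the claim are $0$ because of the factor $j-i$; in particular the $(1,1)$ entry is $0$, although $M_{-1}$ is not defined. *)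

(* Defs.v *)
From HB Require Import structures.
From mathcomp Require Import all_boot all_order all_algebra all_fingroup.

Set Implicit Arguments.
Unset Strict Implicit.
Unset Printing Implicit Defensive.

Import GRing.Theory.
Local Open Scope ring_scope.

Lemma fst_pos_subproof (n : nat) (k : 'I_n) : (k.*2 < n.*2)%N.
Proof. by rewrite ltn_double. Qed.

Lemma snd_pos_subproof (n : nat) (k : 'I_n) : (k.*2.+1 < n.*2)%N.
Proof. by rewrite ltn_Sdouble. Qed.

Definition fst_pos (n : nat) (k : 'I_n) : 'I_n.*2 :=
  Ordinal (fst_pos_subproof k).

Definition snd_pos (n : nat) (k : 'I_n) : 'I_n.*2 :=
  Ordinal (snd_pos_subproof k).

Definition pair_partition (n : nat) (P : {set {set 'I_n.*2}}) : bool :=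
  partition P [set: 'I_n.*2] && [forall (B | B \in P), #|B| == 2%N].

(* With sigma_i = s (i - 1) (indices are shifted to start at 0), this says
   P = {{sigma_1, sigma_2}, ..., {sigma_(2n-1), sigma_(2n)}}. *)
Definition lists (n : nat) (s : 'S_n.*2) (P : {set {set 'I_n.*2}}) : bool :=
  P == [set [set s (fst_pos k); s (snd_pos k)] | k : 'I_n].

(* Every pair partition is listed by some s, so the default value 1 is never
   used on pair partitions. *)
Definition listing (n : nat) (P : {set {set 'I_n.*2}}) : 'S_n.*2 :=
  odflt 1%g [pick s : 'S_n.*2 | lists s P].

(* Only meant for A skew-symmetric with zero diagonal; the summand at P is then
   the same for all s such that lists s P, so the choice made by listing is
   immaterial. *)
Definition pfaffian (R : comPzRingType) (n : nat) (A : 'M[R]_(n.*2)) : R :=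
  \sum_(P : {set {set 'I_n.*2}} | pair_partition P)
    (-1) ^+ (listing P : bool) *
    \prod_(k < n) A (listing P (fst_pos k)) (listing P (snd_pos k)).

Definition motzkin (m : nat) : rat :=
  \sum_(0 <= k < m.+1) (k.+1%:R)^-1 * 'C(m, k.*2)%:R * 'C(k.*2, k)%:R.

(* Row i and column j (counted from 0) are the 1-based indices i.+1 and j.+1.
   The truncated subtraction only matters at i = j = 0, where the entry is 0
   because of the factor j.+1 - i.+1. *)
Definition motzkin_matrix (n : nat) : 'M[rat]_(n.*2) :=
  \matrix_(i < n.*2, j < n.*2)
    ((j.+1%:R - i.+1%:R) * motzkin (i.+1 + j.+1 - 3)).

(* Main.v *)
(* The entry of the matrix at row i and column j (from 0) is <x^i, x^j> for the
   skew form <f, g> = L(f g' - f' g), where L(x^m) = M_m.  The substitution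
   x = y + 1 turns L into the Catalan functional, for which the Chebyshev
   polynomials u_k(y) = U_k(y/2) are orthonormal.  A unitriangular change of
   basis does not affect the Pfaffian; in the basis u_(2a), u_(2b+1) - u_(2b-1) (the
   latter has derivative (2b+1) u_(2b)) two elements of the same parity pair to
   0, and so do u_(2a) and u_(2b+1) - u_(2b-1) for a < b, while for a = b the
   value is 4b+1.  By this triangularity only the partition into the blocks
   {2k, 2k+1} contributes. *)
From HB Require Import structures.
Require Import Defs.
From mathcomp Require Import all_boot all_order all_algebra all_fingroup.
From mathcomp Require Import zify ring.
Import Order.TTheory GRing.Theory Num.Theory.
Local Open Scope ring_scope.

(** * Positions as pairs of a parity and a block *)

Lemma blk_subproof n (i : 'I_n.*2) : (i./2 < n)%N.
Proof. by rewrite ltn_half_double. Qed.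

Definition blk {n} (i : 'I_n.*2) : 'I_n := Ordinal (blk_subproof n i).

Definition pos {n} (b : bool) (k : 'I_n) : 'I_n.*2 :=
  if b then snd_pos k else fst_pos k.

Lemma val_pos n b (k : 'I_n) : pos b k = (b + k.*2)%N :> nat.
Proof. by case: b. Qed.

Lemma blk_pos n b (k : 'I_n) : blk (pos b k) = k.
Proof. by apply: val_inj; rewrite /= val_pos half_bit_double. Qed.

Lemma odd_pos n b (k : 'I_n) : odd (pos b k) = b.
Proof. by rewrite val_pos oddD odd_double addbF oddb. Qed.

Lemma pos_odd_blk n (i : 'I_n.*2) : pos (odd i) (blk i) = i.
Proof. by apply: val_inj; rewrite /= val_pos odd_double_half. Qed.

Lemma pos_inj n b b' (k k' : 'I_n) : pos b k = pos b' k' -> b = b' /\ k = k'.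
Proof.
move=> e; split; first by rewrite -(odd_pos _ b k) e odd_pos.
by rewrite -(blk_pos _ b k) e blk_pos.
Qed.

Lemma big_pos (R : Type) (idx : R) (op : Monoid.com_law idx) n
    (F : 'I_n.*2 -> R) :
  \big[op/idx]_i F i = \big[op/idx]_(k < n) op (F (fst_pos k)) (F (snd_pos k)).
Proof.
rewrite (reindex (fun p : 'I_n * bool => pos p.2 p.1)) /=; last first.
  exists (fun i => (blk i, odd i)) => [[k b] _ | i _] /=.
    by rewrite blk_pos odd_pos.
  exact: pos_odd_blk.
rewrite -(pair_bigA _ (fun k b => F (pos b k))) /=.
by apply: eq_bigr => k _; rewrite big_bool Monoid.mulmC.
Qed.

(** * Pfaffian terms summed over permutations, and congruence *)

Definition pf_term {R : comPzRingType} {n} (A : 'M[R]_(n.*2))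
    (s : 'S_n.*2) : R :=
  (-1) ^+ (s : bool) * \prod_(k < n) A (s (fst_pos k)) (s (snd_pos k)).

(* Pfaffian terms summed over all permutations, so that every pair partition is
   counted the same number of times; for this sum congruence by a matrix reduces
   to the Leibniz formula. *)
Definition pf_sum {R : comPzRingType} {n} (A : 'M[R]_(n.*2)) : R :=
  \sum_(s : 'S_n.*2) pf_term A s.

(** Expanding every entry of the congruent matrix turns the product into a sum over all maps [g] of
    positions to indices; for fixed [g], the sum over [s] is a Leibniz expansion. *)
Lemma pf_sum_congr (R : comPzRingType) n (B A : 'M[R]_(n.*2)) :
  pf_sum (B *m A *m B^T) = \det B * pf_sum A.
Proof.
pose I := 'I_n.*2.
pose T (g : {ffun I -> I}) := \prod_(k < n) A (g (fst_pos k)) (g (snd_pos k)).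
have expand (s : 'S_n.*2) :
    \prod_(k < n) (B *m A *m B^T) (s (fst_pos k)) (s (snd_pos k)) =
    \sum_(g : {ffun I -> I}) T g * \prod_i B (s i) (g i).
  pose F k (p : I * I) :=
    A p.1 p.2 * (B (s (fst_pos k)) p.1 * B (s (snd_pos k)) p.2).
  transitivity (\prod_(k < n) \sum_p F k p).
    apply: eq_bigr => k _.
    rewrite mxE -(pair_bigA _ (fun p q => F k (p, q))) /=.
    rewrite exchange_big; apply: eq_bigr => q _; rewrite !mxE big_distrl /=.
    by apply: eq_bigr => p _; rewrite /F /=; ring.
  rewrite bigA_distr_bigA /=.
  (* A choice of one pair of indices per block is the same as a choice of one index per position. *)
  pose toP (g : {ffun I -> I}) :=
    [ffun k : 'I_n => (g (fst_pos k), g (snd_pos k))].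
  rewrite (reindex toP) /=; last first.
    exists (fun f : {ffun 'I_n -> I * I} =>
      [ffun i : I => if odd i then (f (blk i)).2 else (f (blk i)).1 : I]).
      move=> g _; apply/ffunP => i; rewrite !ffunE /=.
      rewrite -[in RHS](pos_odd_blk n i).
      by case: (odd i).
    move=> f _; apply/ffunP => k; rewrite !ffunE.
    rewrite -[fst_pos k]/(pos false k) -[snd_pos k]/(pos true k).
    rewrite !odd_pos !blk_pos.
    by case: (f k).
  apply: eq_bigr => g _; rewrite /F big_split (big_pos _ _ _ n) /=.
  by congr (_ * _); apply: eq_bigr => k _; rewrite ffunE.
transitivity (\sum_(g : {ffun I -> I}) T g * \det (\matrix_(i, j) B i (g j))).
  transitivity (\sum_(s : 'S_n.*2) \sum_(g : {ffun I -> I})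
      (-1) ^+ (s : bool) * (T g * \prod_i B (s i) (g i))).
    by apply: eq_bigr => s _; rewrite /pf_term expand big_distrr.
  rewrite exchange_big; apply: eq_bigr => g _ /=.
  rewrite -det_tr big_distrr /=; apply: eq_bigr => s _; rewrite mulrCA.
  congr (_ * (_ * _)); rewrite (reindex_perm s^-1%g) [RHS](reindex_perm s^-1%g).
  by apply: eq_bigr => i _; rewrite !mxE.
(* If [g] is not injective, two columns coincide and the determinant is 0; otherwise [g] is a
   permutation and contributes its sign times [\det B]. *)
rewrite (bigID (fun g : {ffun I -> I} => injectiveb g)) /= addrC big1 ?add0r.
  rewrite (reindex (@pval _)) /=; last first.
    pose in_Sn := insubd (1%g : 'S_n.*2).
    by exists in_Sn => /= f Uf; first apply: val_inj; apply: insubdK.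
  rewrite mulr_sumr; apply: eq_big => /= [s | s _]; rewrite ?(valP s) //.
  have -> : \matrix_(i, j) B i (val s j) = col_perm s B.
    by apply/matrixP => i j; rewrite !mxE -pvalE.
  rewrite col_permE det_mulmx det_perm odd_permV /pf_term mulrC -mulrA.
  by congr (_ * (_ * _)); apply: eq_bigr => k _; rewrite -!pvalE.
move=> g /injectivePn [i1 [i2 Di12 Ef12]].
rewrite -det_tr (determinant_alternate Di12) ?mulr0 // => j.
by rewrite !mxE Ef12.
Qed.

(** * Permutations preserving the blocks *)

(** This is the hyperoctahedral group, the stabilizer of the partition into the blocks {2k, 2k+1};
    its order is the multiplicity of each pair partition in [pf_sum]. *)
Definition blk_preserving {n} (h : 'S_n.*2) : bool :=
  [forall k, blk (h (fst_pos k)) == blk (h (snd_pos k))].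

(** The wreath product form: [p] permutes the blocks, and [f k] tells whether block [k] is
    reversed. *)
Lemma blk_preservingP n (h : 'S_n.*2) : reflect
  (exists (p : 'S_n) (f : 'I_n -> bool),
     forall b k, h (pos b k) = pos (b (+) f k) (p k))
  (blk_preserving h).
Proof.
apply: (iffP forallP) => [hB | [p [f hE]] k]; last first.
  by rewrite (hE false) (hE true) !blk_pos.
have hblk k : blk (h (fst_pos k)) = blk (h (snd_pos k)) by apply/eqP.
pose f k := odd (h (fst_pos k)).
have f_snd k : odd (h (snd_pos k)) = ~~ f k.
  rewrite /f; have [e|] := eqVneq (odd (h (fst_pos k))) (odd (h (snd_pos k)));
    last by do 2!case: odd.
  have /perm_inj/(pos_inj _ false true)[] // : h (pos false k) = h (pos true k).
  rewrite -(pos_odd_blk _ (h (pos false k))) -(pos_odd_blk _ (h (pos true k))).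
  by rewrite /= hblk e.
have hE b k : h (pos b k) = pos (b (+) f k) (blk (h (fst_pos k))).
  rewrite -[LHS]pos_odd_blk; case: b; rewrite /= ?f_snd ?hblk //.
have pinj : injective (fun k => blk (h (fst_pos k))).
  move=> k k' /= e.
  (* The positions [pos (f k) k] and [pos (f k') k'] both go to the even position of the common
     image block. *)
  have /perm_inj/pos_inj [] // : h (pos (f k) k) = h (pos (f k') k').
  by rewrite !hE !addbb e.
by exists (perm pinj), f => b k; rewrite permE hE.
Qed.

(** The sign of the transposition cancels the sign from skew-symmetry. In [(t * s)%g] the left
    factor acts first, hence on positions. *)
Lemma pf_term_flip (R : comPzRingType) n (A : 'M[R]_(n.*2)) (k : 'I_n)
    (s : 'S_n.*2) :
    (forall i j, A j i = - A i j) ->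
  pf_term A (tperm (fst_pos k) (snd_pos k) * s)%g = pf_term A s.
Proof.
move=> skewA; have nk : fst_pos k != snd_pos k.
  by apply/eqP => /(pos_inj _ false true) [].
rewrite /pf_term odd_permM odd_tperm nk signr_addb mulN1r !mulNr -mulrN.
congr (_ * _); rewrite (bigD1 k) //= [in RHS](bigD1 k) //= !permM tpermL tpermR.
rewrite -mulNr -skewA; congr (_ * _); apply: eq_bigr => j njk.
rewrite !permM !tpermD //; apply/negP => /eqP.
- by move/(pos_inj _ false true) => [].
- by move/(pos_inj _ true true) => [_ e]; rewrite e eqxx in njk.
- by move/(pos_inj _ false false) => [_ e]; rewrite e eqxx in njk.
by move/(pos_inj _ true false) => [].
Qed.

Definition blk_swap {n} (i j : 'I_n) : 'S_n.*2 :=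
  (tperm (fst_pos i) (fst_pos j) * tperm (snd_pos i) (snd_pos j))%g.

Lemma blk_swap_pos n (i j : 'I_n) b k :
  blk_swap i j (pos b k) = pos b (tperm i j k).
Proof.
rewrite /blk_swap permM.
have D b1 b2 (k1 k2 : 'I_n) : b1 != b2 -> pos b1 k1 != pos b2 k2.
  by move/eqP=> nb; apply/eqP => /pos_inj [].
have E b' : tperm (pos b' i) (pos b' j) (pos b' k) = pos b' (tperm i j k).
  case: (tpermP i j k) => [->|->|ni nj]; rewrite ?tpermL ?tpermR //.
  by rewrite tpermD //; apply/eqP => /pos_inj [_ /esym].
case: b.
  by rewrite (tpermD (D false true i k isT) (D false true j k isT)) (E true).
by rewrite [tperm _ _ (pos false k)](E false)
  (tpermD (D true false i _ isT) (D true false j _ isT)).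
Qed.

(** Exchanging two blocks takes two transpositions, so the sign is kept and the factors are only
    reordered. *)
Lemma pf_term_swap (R : comPzRingType) n (A : 'M[R]_(n.*2)) (i j : 'I_n)
    (s : 'S_n.*2) :
  pf_term A (blk_swap i j * s)%g = pf_term A s.
Proof.
rewrite /pf_term !odd_permM !odd_tperm.
have -> : (fst_pos i != fst_pos j) = (snd_pos i != snd_pos j).
  by rewrite -!val_eqE.
rewrite addbA addbb addFb; congr (_ * _).
rewrite [RHS](reindex_perm (tperm i j)); apply: eq_bigr => k _.
rewrite !(permM (blk_swap i j)).
by rewrite -[fst_pos k]/(pos false k) -[snd_pos k]/(pos true k) !blk_swap_pos.
Qed.

(** A permutation of the blocks is a product of transpositions, each of which lifts to a
    [blk_swap]. *)
Lemma pf_term_lift (R : comPzRingType) n (A : 'M[R]_(n.*2)) (p : 'S_n) :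
  exists2 l : 'S_n.*2,
  (forall b k, l (pos b k) = pos b (p k)) &
  forall s, pf_term A (l * s)%g = pf_term A s.
Proof.
have [ts -> _] := prod_tpermP p; elim: ts => [|t ts [l lE lA]].
  by exists 1%g => [b k|s]; rewrite ?big_nil ?perm1 ?mul1g.
exists (blk_swap t.1 t.2 * l)%g => [b k|s].
  by rewrite big_cons (permM (blk_swap _ _)) permM blk_swap_pos lE.
by rewrite -mulgA pf_term_swap.
Qed.

Lemma pf_term_flips (R : comPzRingType) n (A : 'M[R]_(n.*2))
    (f : 'I_n -> bool) :
    (forall i j, A j i = - A i j) ->
  exists2 l : 'S_n.*2,
  (forall b k, l (pos b k) = pos (b (+) f k) k) &
  forall s, pf_term A (l * s)%g = pf_term A s.
Proof.
(* The list in the induction contains the blocks already treated; the others are left fixed. *)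
move=> skewA; have [l lE lA] : exists2 l : 'S_n.*2,
    (forall b k, l (pos b k) =
       if k \in enum 'I_n then pos (b (+) f k) k else pos b k) &
    forall s, pf_term A (l * s)%g = pf_term A s.
  elim: (enum 'I_n) (enum_uniq 'I_n) => [_|j r IH /= /andP[jr ur]].
    by exists 1%g => [b k|s]; rewrite ?perm1 ?mul1g.
  have [l lE lA] := IH ur.
  pose t := tperm (pos false j) (pos true j).
  exists (if f j then t * l else l)%g => [b k|s]; last first.
    by case: (f j); rewrite ?lA // -mulgA pf_term_flip.
  rewrite inE; have [->|nkj] /= := eqVneq k j.
    have tb : t (pos b j) = pos (~~ b) j by case: b; rewrite ?tpermL ?tpermR.
    by case: (f j); rewrite ?permM ?tb lE (negPf jr) ?addbT ?addbF.
  rewrite -lE; case: (f j) => //; rewrite permM tpermD //;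
    by apply: contra_neq nkj => /pos_inj [].
by exists l => // b k; rewrite lE mem_enum.
Qed.

Lemma pf_term_blk (R : comPzRingType) n (A : 'M[R]_(n.*2)) (h s : 'S_n.*2) :
    (forall i j, A j i = - A i j) ->
  blk_preserving h -> pf_term A (h * s)%g = pf_term A s.
Proof.
move=> skewA /blk_preservingP [p [f hE]].
have [l lE lA] := pf_term_lift R n A p.
have [m mE mA] := pf_term_flips R n A f skewA.
have -> : h = (m * l)%g; last by rewrite -mulgA mA lA.
by apply/permP => i; rewrite -(pos_odd_blk _ i) permM mE lE hE.
Qed.

(** * Pair partitions and their listings *)

Definition blocks {n} (s : 'S_n.*2) : {set {set 'I_n.*2}} :=
  [set [set s (fst_pos k); s (snd_pos k)] | k : 'I_n].

Lemma mem_block n (s : 'S_n.*2) k i :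
  (i \in [set s (fst_pos k); s (snd_pos k)]) = (blk (s^-1%g i) == k).
Proof.
rewrite !inE ![i == _]eq_sym !(canF_eq (permK s)).
apply/orP/eqP => [[]/eqP<-|<-].
- exact: (blk_pos _ false).
- exact: (blk_pos _ true).
by have := pos_odd_blk _ (s^-1%g i); case: odd => /= e; [right|left]; apply/eqP.
Qed.

Lemma pair_partition_blocks n (s : 'S_n.*2) : pair_partition (blocks s).
Proof.
apply/andP; split; last first.
  apply/forallP => B; apply/implyP => /imsetP [k _ ->].
  rewrite cards2 (inj_eq perm_inj) -val_eqE /=.
  by rewrite neq_ltn ltnSn.
apply/and3P; split.
- apply/eqP/setP => i; rewrite in_setT; apply/bigcupP.
  exists [set s (fst_pos (blk (s^-1%g i))); s (snd_pos (blk (s^-1%g i)))].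
    exact: imset_f.
  by rewrite mem_block.
- apply/trivIsetP => _ _ /imsetP [k _ ->] /imsetP [k' _ ->].
  apply: contra_neqT => /pred0Pn [i /=]; rewrite !mem_block.
  by case/andP=> /eqP -> /eqP ->.
by apply/imsetP => -[k _ /setP /(_ (s (fst_pos k)))]; rewrite !inE eqxx.
Qed.

(** All cells have two elements, so there are [n] of them; enumerating the cells, and then the
    elements of each cell, gives the listing. *)
Lemma pair_partition_listed n (P : {set {set 'I_n.*2}}) :
  pair_partition P -> exists s, lists s P.
Proof.
case/andP=> partP /forallP card2.
have P2 B : B \in P -> #|B| = 2.
  by move=> BP; apply/eqP; move/implyP: (card2 B); apply.
have cardP : #|P| = n.
  have := card_uniform_partition P2 partP; rewrite cardsT card_ord; lia.
pose B (k : 'I_n) := enum_val (cast_ord (esym cardP) k).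
have BP k : B k \in P by apply: enum_valP.
have B2 k : size (enum (B k)) = 2 by rewrite -cardE P2.
pose s0 i := nth i (enum (B (blk i))) (odd i).
have s0B i : s0 i \in B (blk i) by rewrite -mem_enum mem_nth // B2; case: odd.
have s0_inj : injective s0.
  move=> i j e; have [_ /trivIsetP tI _] := and3P partP.
  have eb : blk i = blk j.
    have : B (blk i) = B (blk j).
      apply/eqP; apply: contraT => nB.
      have /pred0Pn [] := tI _ _ (BP _) (BP _) nB.
      by exists (s0 i); rewrite /= s0B e s0B.
    by move/enum_val_inj/cast_ord_inj.
  rewrite -(pos_odd_blk _ i) -(pos_odd_blk _ j) eb; congr pos.
  (* The two occurrences of [nth] have different default values; both indices are below 2, so the
     default can be changed. *)
  move/eqP: e; rewrite /s0 eb (set_nth_default j) ?B2; last by case: odd.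
  by rewrite nth_uniq ?enum_uniq ?B2; do 2!case: odd.
exists (perm s0_inj).
have BE k : B k = [set perm s0_inj (fst_pos k); perm s0_inj (snd_pos k)].
  apply/esym/eqP; rewrite eqEcard P2 // cards2 (inj_eq perm_inj) -val_eqE /=.
  rewrite neq_ltn ltnSn andbT; apply/subsetP => i; rewrite !inE !permE.
  have s0Bk b : s0 (pos b k) \in B k by rewrite -{2}(blk_pos _ b k).
  by case/orP => /eqP->; [apply: (s0Bk false) | apply: (s0Bk true)].
apply/eqP/setP => C; apply/idP/imsetP => [CP|[k _ ->]]; last by rewrite -BE.
exists (cast_ord cardP (enum_rank_in CP C)) => //.
by rewrite -BE /B cast_ordK enum_rankK_in.
Qed.

Lemma lists_listing n (P : {set {set 'I_n.*2}}) :
  pair_partition P -> lists (listing P) P.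
Proof.
by move/pair_partition_listed => [s sP]; rewrite /listing;
  case: pickP => // /(_ s);
  rewrite sP.
Qed.

(** The listings of a pair partition thus form one coset of the block-preserving permutations. *)
Lemma lists_blk_preserving n (h s : 'S_n.*2) P :
  lists s P -> lists (h * s)%g P = blk_preserving h.
Proof.
move=> /eqP ->; apply/eqP/blk_preservingP => [e | [p [f hE]]].
  apply/blk_preservingP/forallP => k.
  have : [set (h * s)%g (fst_pos k); (h * s)%g (snd_pos k)] \in blocks s.
    by rewrite [blocks s]e; apply: imset_f.
  case/imsetP=> j _ /setP E.
  have := E ((h * s)%g (fst_pos k)); have := E ((h * s)%g (snd_pos k)).
  rewrite !mem_block !permK (blk_pos _ false) (blk_pos _ true) eqxx
    !permM !permK.
  by move=> /esym/eqP -> /esym/eqP ->.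
have swap q : [set (h * s)%g (fst_pos q); (h * s)%g (snd_pos q)] =
              [set s (fst_pos (p q)); s (snd_pos (p q))].
  rewrite !permM (hE false) (hE true); case: (f q) => //=.
  by rewrite setUC.
apply/setP => C; apply/imsetP/imsetP => -[q _ ->]; last by exists (p q).
by exists (p^-1%g q); rewrite ?swap ?permKV.
Qed.

(** The fibres of [blocks] are such cosets, and [pf_term] is constant on each of them. *)
Lemma pf_sumE (R : comPzRingType) n (A : 'M[R]_(n.*2)) :
    (forall i j, A j i = - A i j) ->
  pf_sum A = pfaffian A *+ #|[pred h : 'S_n.*2 | blk_preserving h]|.
Proof.
move=> skewA; rewrite /pf_sum.
rewrite (partition_big blocks (@pair_partition n)) /=; last first.
  by move=> s _; apply: pair_partition_blocks.
rewrite /pfaffian -sumrMnl; apply: eq_bigr => P /lists_listing sP.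
rewrite -[_ * _]/(pf_term A (listing P)) -sumr_const.
rewrite (reindex_inj (mulIg (listing P))); apply: eq_big => h.
  by rewrite inE -(lists_blk_preserving _ _ _ _ sP) /lists eq_sym.
rewrite eq_sym => hs.
by rewrite pf_term_blk // -(lists_blk_preserving _ _ _ _ sP).
Qed.

(** Every remaining term equals that of the identity. *)
Lemma pf_sum_blk (R : comPzRingType) n (A : 'M[R]_(n.*2)) :
    (forall i j, A j i = - A i j) ->
    (forall s, ~~ blk_preserving s -> pf_term A s = 0) ->
  pf_sum A = (\prod_(k < n) A (fst_pos k) (snd_pos k)) *+
             #|[pred h : 'S_n.*2 | blk_preserving h]|.
Proof.
move=> skewA A0.
rewrite /pf_sum (bigID blk_preserving) /= [X in _ + X]big1 // addr0.
rewrite -sumr_const; apply: eq_bigr => h hB; rewrite -[h]mulg1 pf_term_blk //.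
by rewrite /pf_term odd_perm1 mul1r; apply: eq_bigr => k _; rewrite !perm1.
Qed.

(** * Ballot and Catalan numbers *)

(* [ballot m k] is the number of nonnegative walks of m steps +1 or -1 from 0 to
   k, which is the coefficient of u_k in y^m. *)
Fixpoint ballot (m k : nat) : nat :=
  if m is m'.+1 then (if k is k'.+1 then ballot m' k' else 0) + ballot m' k.+1
  else (k == 0).

Arguments ballot : simpl never.

Lemma ballotS0 m : ballot m.+1 0 = ballot m 1.
Proof. by []. Qed.

Lemma ballotSS m k : ballot m.+1 k.+1 = (ballot m k + ballot m k.+2)%N.
Proof. by []. Qed.

Lemma ballot_lt m k : (m < k)%N -> ballot m k = 0%N.
Proof.
by elim: m k => [|m IH] [|k] // mk; rewrite ?ballotS0 ?ballotSS !IH //; lia.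
Qed.

Lemma ballot_odd m k : odd (m + k) -> ballot m k = 0%N.
Proof.
by elim: m k => [|m IH] [|k] // mk; rewrite ?ballotS0 ?ballotSS !IH //; lia.
Qed.

(** The reflection principle, written additively to avoid truncated subtraction; the value 0 at
    [j = 0] stands for a binomial coefficient with lower index -1. Both inductions use Pascal's
    rule. *)
Lemma ballot_bin j k :
  (ballot (j.*2 + k) k + (if j is j'.+1 then 'C(j.*2 + k, j') else 0) =
   'C(j.*2 + k, j))%N.
Proof.
elim: j k => [|j IHj] k.
  by rewrite bin0 addn0; elim: k => // k IHk; rewrite ballotSS IHk ballot_lt.
elim: k => [|k IHk].
  have := IHj 1; rewrite addn1 addn0 doubleS ballotS0 (binS j.*2.+1 j).
  have -> : 'C(j.*2.+1, j.+1) = 'C(j.*2.+1, j).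
    by rewrite -bin_sub; [congr binomial; lia | lia].
  case: (j) => [|j'] //; rewrite (binS j'.+1.*2.+1 j').
  by move: (ballot _ 1) 'C(_, j'.+1) 'C(_, j') => *; lia.
have := IHj k.+2; move: IHk.
have -> : (j.+1.*2 + k = j.*2 + k.+2)%N by lia.
have -> : (j.+1.*2 + k.+1 = (j.*2 + k.+2).+1)%N by lia.
rewrite ballotSS (binS (j.*2 + k.+2) j) .
move: (ballot _ k) (ballot _ k.+2) => x y; case: (j) => [|j'].
  by rewrite !bin0; lia.
rewrite (binS (j'.+1.*2 + k.+2) j').
by move: 'C(_, j'.+2) 'C(_, j'.+1) 'C(_, j') => *; lia.
Qed.

Lemma ballot_catalan k : (k.+1 * ballot k.*2 0 = 'C(k.*2, k))%N.
Proof.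
have := ballot_bin k 0; rewrite addn0; case: k => [|k] //= e.
(* With j = k+1 this reads j C(2j,j) = (j+1) C(2j,j-1), which eliminates the subtracted
   coefficient. *)
have := mul_bin_left k.+1.*2 k; rewrite -e.
have -> : (k.+1.*2 - k = k.+2)%N by lia.
nia.
Qed.

(** * Moment functionals and Chebyshev polynomials *)

Definition moment_form {R : comNzRingType} (mu : nat -> R) (p : {poly R}) : R :=
  \sum_(i < size p) p`_i * mu i.

Lemma moment_formE {R : comNzRingType} (mu : nat -> R) N (p : {poly R}) :
  (size p <= N)%N ->
  moment_form mu p = \sum_(i < N) p`_i * mu i.
Proof.
move=> pN; rewrite /moment_form (big_ord_widen N (fun i => p`_i * mu i) pN).
rewrite big_mkcond; apply: eq_bigr => i _; case: ltnP => // si.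
by rewrite nth_default ?mul0r.
Qed.

Lemma moment_form_is_linear {R : comNzRingType} (mu : nat -> R) :
  linear_for *%R (moment_form mu).
Proof.
move=> a p q; pose N := maxn (size p) (size q).
have sp : (size p <= N)%N by rewrite leq_maxl.
have sq : (size q <= N)%N by rewrite leq_maxr.
have spq : (size (a *: p + q)%R <= N)%N.
  by rewrite (leq_trans (size_polyD _ _)) // geq_max sq
    (leq_trans (size_scale_leq _ _)).
rewrite !(moment_formE mu N) // mulr_sumr -big_split /=; apply: eq_bigr => i _.
by rewrite coefD coefZ mulrDl mulrA.
Qed.

HB.instance Definition _ {R : comNzRingType} (mu : nat -> R) :=
  GRing.isLinear.Build R {poly R} R *%R (moment_form mu)
    (moment_form_is_linear mu).

Lemma moment_formXn {R : comNzRingType} (mu : nat -> R) m :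
  moment_form mu 'X^m = mu m.
Proof.
rewrite (moment_formE mu m.+1) ?size_polyXn // big_ord_recr /=.
rewrite coefXn eqxx mul1r.
by rewrite big1 ?add0r // => i _; rewrite coefXn ltn_eqF ?mul0r.
Qed.

(* chebU k is U_k(y/2), hence monic, with U_k the Chebyshev polynomial of the
   second kind. *)
Fixpoint chebU (k : nat) : {poly rat} :=
  if k is k'.+1 then if k' is k''.+1 then 'X * chebU k' - chebU k'' else 'X
  else 1.

Arguments chebU : simpl never.

Lemma chebUSS k : chebU k.+2 = 'X * chebU k.+1 - chebU k.
Proof. by []. Qed.

(** The moments of the semicircle law on [-2,2]: Catalan numbers in even degree, 0 in odd degree. *)
Definition catalan_form : {poly rat} -> rat :=
  moment_form (fun m => (ballot m 0)%:R).

HB.instance Definition _ := GRing.Linear.on catalan_form.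

(** The three-term recurrence of [chebU] mirrors the last-step recurrence of [ballot]; as it reaches
    back two indices, two consecutive cases are carried together. *)
Lemma catalan_form_chebU m k :
  catalan_form ('X^m * chebU k) = (ballot m k)%:R.
Proof.
suff : (forall m, catalan_form ('X^m * chebU k) = (ballot m k)%:R) /\
    (forall m, catalan_form ('X^m * chebU k.+1) = (ballot m k.+1)%:R) by case.
elim: k {m} => [|k [IH0 IH1]]; split=> // m.
- by rewrite mulr1; apply: moment_formXn.
- by rewrite -exprSr [LHS]moment_formXn.
rewrite chebUSS mulrBr mulrA -exprSr linearB /= IH0 IH1.
by rewrite [ballot m.+1 _]/= natrD addrC addKr.
Qed.

(** Multiplication by ['X] can be moved from one factor to the other, where it yields the sum of the
    two neighbours, with u_(-1) = 0. *)
Lemma chebU_orthonormal i k : catalan_form (chebU i * chebU k) = (i == k)%:R.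
Proof.
suff : (forall k, catalan_form (chebU i * chebU k) = (i == k)%:R) /\
    (forall k, catalan_form (chebU i.+1 * chebU k) = (i.+1 == k)%:R) by case.
elim: i {k} => [|i [IH0 IH1]]; split=> // k.
- by rewrite -[chebU 0](expr0 'X) catalan_form_chebU eq_sym.
- by rewrite -[chebU 1](expr1 'X) catalan_form_chebU; case: k => [|[|k]].
rewrite chebUSS mulrBl linearB /= -mulrA mulrCA.
have -> : 'X * chebU k = chebU k.+1 + (if k is k'.+1 then chebU k' else 0).
  by case: k => [|k]; rewrite ?mulr1 ?addr0 // chebUSS subrK.
rewrite mulrDr linearD /= IH1 IH0.
case: k => [|k]; first by rewrite mulr0 linear0 eqSS addr0 subrr.
by rewrite IH1 !eqSS addrAC subrr add0r.
Qed.

Lemma chebU_deriv k :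
  (chebU k.+2)^`() = (chebU k)^`() + chebU k.+1 *+ k.+2.
Proof.
suff : (chebU k.+2)^`() = (chebU k)^`() + chebU k.+1 *+ k.+2 /\
   (chebU k.+3)^`() = (chebU k.+1)^`() + chebU k.+2 *+ k.+3 by case.
elim: k => [|k [IH0 IH1]].
  rewrite !chebUSS -[chebU 1]/'X -[chebU 0]/(1%:P : {poly rat}).
  by split; rewrite !derivE; ring.
split=> //.
(* This is the derivative of the three-term recurrence. *)
have e : 'X * (chebU k.+1)^`() = (chebU k.+2)^`() + (chebU k)^`() - chebU k.+1.
  by rewrite chebUSS !derivE; ring.
rewrite [in LHS]chebUSS derivB derivM derivX mul1r IH1 mulrDr e IH0.
by rewrite (chebUSS k.+1); ring.
Qed.

(** Iterating [chebU_deriv] writes the derivative of u_j as the sum of (i+1) u_i over i < j of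
    opposite parity; orthonormality extracts the coefficient. *)
Lemma chebU_pairing i j :
  catalan_form (chebU i * (chebU j)^`()) =
  (if (i < j)%N && odd (i + j) then i.+1 else 0)%:R.
Proof.
pose D j := catalan_form (chebU i * (chebU j)^`()) =
  (if (i < j)%N && odd (i + j) then i.+1 else 0)%:R.
suff : D j /\ D j.+1 by case.
rewrite /D {D}; elim: j => [|j [IH0 IH1]].
  rewrite -[chebU 1]/'X -[chebU 0]/(1%:P : {poly rat}) derivC derivX.
  rewrite mulr0 linear0.
  split=> //; rewrite -[1 in LHS]/(chebU 0) chebU_orthonormal.
  by case: i => [|i]; rewrite ?ltnS.
split=> //; rewrite chebU_deriv mulrDr mulrnAr linearD linearMn /=.
rewrite chebU_orthonormal.
rewrite IH0 -mulrnA -natrD; congr (_%:R).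
by case: eqP => [->|ne]; do 2!case: ifP; lia.
Qed.

(** * The skew form in the adapted basis *)

(** For odd [i] this is 2 T_i(y/2), with T_i the Chebyshev polynomial of the first kind; at [i = 1]
    the subtracted u_(-1) is 0. *)
Definition cheb_basis (i : nat) : {poly rat} :=
  if odd i then chebU i - (if i is i'.+2 then chebU i' else 0) else chebU i.

Definition skew_form (p q : {poly rat}) : rat :=
  catalan_form (p * q^`() - p^`() * q).

Lemma skew_formC p q : skew_form q p = - skew_form p q.
Proof. by rewrite /skew_form -linearN; congr catalan_form; ring. Qed.

Lemma cheb_basis_deriv_odd i : odd i -> (cheb_basis i)^`() = chebU i.-1 *+ i.
Proof.
rewrite /cheb_basis => oi; rewrite oi; case: i oi => [|[|i]] // _.
  by rewrite subr0 derivX.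
by rewrite derivB chebU_deriv addrC addKr.
Qed.

Lemma catalan_form_odd i k : odd i -> ~~ odd k ->
  catalan_form (cheb_basis i * chebU k) = 0.
Proof.
rewrite /cheb_basis => oi ok; rewrite oi; case: i oi => [|[|i]] // oi.
  by rewrite subr0 chebU_orthonormal; case: k ok => [|[|k]].
rewrite mulrBl linearB /= !chebU_orthonormal.
have -> : (i.+2 == k) = false.
  by apply/eqP => e; move: oi ok; rewrite -e => ->.
have -> : (i == k) = false.
  by apply/eqP => e; move: oi ok; rewrite -e /= negbK => ->.
by rewrite subrr.
Qed.

(** Differentiation changes parity, and Chebyshev polynomials of opposite parity are orthogonal. *)
Lemma skew_form_parity i j : odd i = odd j ->
  skew_form (cheb_basis i) (cheb_basis j) = 0.
Proof.
move=> e; rewrite /skew_form; case oi: (odd i).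
  have oj : odd j by rewrite -e.
  rewrite !cheb_basis_deriv_odd // mulrnAr mulrnAl linearB !linearMn /=.
  rewrite (mulrC (chebU i.-1)) !catalan_form_odd ?mul0rn ?subrr //; lia.
rewrite /cheb_basis oi -e oi linearB /= mulrC [X in _ - catalan_form X]mulrC.
rewrite [X in catalan_form X - _]mulrC.
by rewrite !chebU_pairing !oddD -e oi !andbF subrr.
Qed.

Lemma skew_form_even_odd a b : (a <= b)%N ->
  skew_form (cheb_basis a.*2) (cheb_basis b.*2.+1) =
  if a == b then (4 * b + 1)%:R else 0.
Proof.
move=> ab; rewrite /skew_form cheb_basis_deriv_odd /= ?odd_double //.
rewrite [cheb_basis a.*2]/cheb_basis odd_double mulrnAr linearB linearMn /=.
rewrite chebU_orthonormal.
rewrite mulrC [cheb_basis _]/cheb_basis /= odd_double /=.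
case: b ab => [|b] ab.
  have -> : a = 0%N by lia.
  by rewrite subr0 chebU_pairing.
rewrite doubleS mulrBl linearB /= !chebU_pairing.
have -> : (b.+1.*2.+1 < a.*2)%N = false by lia.
rewrite -!doubleS (inj_eq double_inj).
(* Here [b] stands for b-1. As a <= b, the derivative of u_(2a) involves u_(2b-1) only for a = b,
   with coefficient 2b; together with 2b+1 this gives 4b+1. *)
have -> : (b.*2.+1 < a.*2)%N = (a == b.+1) by lia.
have -> : odd (b.*2.+1 + a.*2) by lia.
case: eqP => _ /=; last by rewrite mul0rn !subr0.
rewrite sub0r opprK -natrD; congr (_%:R); lia.
Qed.

(** * Motzkin moments and the change of basis *)

Lemma catalan_form_XD1n m : catalan_form (('X + 1) ^+ m) = motzkin m.
Proof.
have term j : catalan_form ('X^j *+ 'C(m, j)) = (ballot j 0 * 'C(m, j))%:R.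
  rewrite linearMn /= -[catalan_form _]/(moment_form _ _).
  by rewrite moment_formXn natrM mulr_natr.
rewrite exprD1n linear_sum /= (eq_bigr _ (fun j _ => term (nat_of_ord j))).
(* The range is doubled so that the indices split into pairs 2k, 2k+1 with k <= m: odd indices
   contribute 0, and even ones give Catalan numbers. *)
rewrite (big_ord_widen _ (fun j => (ballot j 0 * 'C(m, j))%:R)
  (leq_addl m.+1 m.+1)).
rewrite big_mkcond addnn big_pos /motzkin big_mkord; apply: eq_bigr => k _ /=.
rewrite (@ballot_odd k.*2.+1) ?addn0 /= ?odd_double // mul0n if_same addr0.
rewrite -(ballot_catalan k) !natrM; case: ltnP => km.
  have : k.+1%:R != 0 :> rat by rewrite pnatr_eq0.
  by move: (k.+1%:R : rat) => c c0; field.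
by rewrite bin_small // mulr0 mul0r.
Qed.

Lemma size_chebU k : size (chebU k) = k.+1 /\ chebU k \is monic.
Proof.
suff : (size (chebU k) = k.+1 /\ chebU k \is monic) /\
   (size (chebU k.+1) = k.+2 /\ chebU k.+1 \is monic) by case.
elim: k => [|k [[s0 m0] [s1 m1]]].
  by split; rewrite ?size_polyC ?monic1 ?size_polyX ?monicX.
split=> //; have lt : (size (- chebU k) < size ('X * chebU k.+1)%R)%N.
  by rewrite size_polyN s0 mulrC size_mulX ?s1 // -size_poly_eq0 s1.
rewrite chebUSS size_polyDl // monicE lead_coefDl //.
rewrite lead_coef_Mmonic // lead_coefX.
by rewrite mulrC size_mulX ?s1 // -size_poly_eq0 s1.
Qed.

Lemma size_cheb_basis i : size (cheb_basis i) = i.+1 /\ cheb_basis i \is monic.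
Proof.
rewrite /cheb_basis; case: ifP => _; last exact: size_chebU.
case: i => [|[|i]]; rewrite ?subr0; try exact: size_chebU.
have [s0 m0] := size_chebU i.+2; have [s1 m1] := size_chebU i.
have lt : (size (- chebU i) < size (chebU i.+2))%N by rewrite size_polyN s0 s1.
by rewrite size_polyDl // s0 monicE lead_coefDl // -monicE.
Qed.

(** The basis polynomials are in y, so composing with x - 1 gives their coordinates in the powers of
    x = y + 1. *)
Definition cheb_matrix n : 'M[rat]_n :=
  \matrix_(i, a) (cheb_basis i \Po ('X - 1%:P))`_a.

Lemma size_cheb_basis_shift i : size (cheb_basis i \Po ('X - 1%:P)) = i.+1.
Proof.
by rewrite size_comp_poly2 ?size_XsubC //; case: (size_cheb_basis i).
Qed.

Lemma det_cheb_matrix n : \det (cheb_matrix n) = 1.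
Proof.
rewrite det_trig; last first.
  apply/is_trig_mxP => i j ij.
  by rewrite mxE nth_default // size_cheb_basis_shift.
apply: big1 => i _; rewrite mxE.
transitivity (lead_coef (cheb_basis i \Po ('X - 1%:P))).
  by rewrite lead_coefE size_cheb_basis_shift.
rewrite lead_coef_comp ?size_XsubC //.
have [_ /monicP ->] := size_cheb_basis i.
by rewrite lead_coefXsubC expr1n mulr1.
Qed.

Lemma cheb_basis_expand n (i : 'I_n) :
  cheb_basis i = \sum_(a < n) cheb_matrix n i a *: ('X + 1) ^+ a.
Proof.
have {1}-> : cheb_basis i = (cheb_basis i \Po ('X - 1%:P)) \Po ('X + 1).
  by rewrite -comp_polyA comp_polyB comp_polyX comp_polyC addrK comp_polyXr.
rewrite comp_polyE size_cheb_basis_shift.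
rewrite (big_ord_widen n (fun a =>
  (cheb_basis i \Po ('X - 1%:P))`_a *: ('X + 1) ^+ a)) //.
rewrite big_mkcond; apply: eq_bigr => a _; rewrite mxE; case: ltnP => // ia.
by rewrite nth_default ?scale0r // size_cheb_basis_shift.
Qed.

Lemma skew_form_XD1n i j :
  skew_form (('X + 1) ^+ i) (('X + 1) ^+ j) =
  (j.+1%:R - i.+1%:R) * motzkin (i.+1 + j.+1 - 3).
Proof.
have dX1 : ('X + 1 : {poly rat})^`() = 1 by rewrite derivD derivX derivC addr0.
rewrite /skew_form !deriv_exp dX1 !mul1r.
rewrite mulrnAr mulrnAl -!exprD linearB !linearMn /= !catalan_form_XD1n.
(* A truncated exponent [0.-1] occurs only with multiplicity 0, so the cases with a zero index are
   treated apart. *)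
case: i j => [|i] [|j].
- by rewrite !subrr mul0r.
- rewrite mulr0n subr0 -(mulr_natl (motzkin _)).
  by congr (_ * motzkin _); [ring | lia].
- rewrite mulr0n sub0r -(mulr_natl (motzkin _)) -mulNr.
  by congr (_ * motzkin _); [ring | lia].
have -> : (i.+1 + j.+1.-1 = i.+2 + j.+2 - 3)%N by lia.
have -> : (i.+1.-1 + j.+1 = i.+2 + j.+2 - 3)%N by lia.
by rewrite -!(mulr_natl (motzkin _)); ring.
Qed.

Definition cheb_gram n : 'M[rat]_(n.*2) :=
  \matrix_(i, j) skew_form (cheb_basis i) (cheb_basis j).

Lemma skew_form_suml (I : finType) (c : I -> rat) (v : I -> {poly rat}) q :
  skew_form (\sum_i c i *: v i) q = \sum_i c i * skew_form (v i) q.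
Proof.
have dE : (\sum_i c i *: v i)^`() = \sum_i c i *: (v i)^`().
  by rewrite raddf_sum; apply: eq_bigr => i _; apply: derivZ.
rewrite /skew_form dE !mulr_suml -sumrB linear_sum; apply: eq_bigr => i _.
by rewrite /= -!scalerAl -scalerBr linearZ.
Qed.

Lemma cheb_gramE n :
  cheb_gram n = cheb_matrix n.*2 *m motzkin_matrix n *m (cheb_matrix n.*2)^T.
Proof.
apply/matrixP => i j; rewrite [LHS]mxE [in LHS]cheb_basis_expand skew_form_suml.
rewrite -mulmxA [RHS]mxE; apply: eq_bigr => a _; congr (_ * _).
(* Linearity in the second argument comes from the first by skew-symmetry. *)
rewrite skew_formC [in LHS]cheb_basis_expand skew_form_suml -sumrN [RHS]mxE.
apply: eq_bigr => b _.
by rewrite -mulrN -skew_formC skew_form_XD1n !mxE mulrC.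
Qed.

Lemma cheb_gram_skew n i j : cheb_gram n j i = - cheb_gram n i j.
Proof. by rewrite !mxE skew_formC. Qed.

(** * Triangularity and the final evaluation *)

Lemma pf_term_cheb_gram n (s : 'S_n.*2) :
  ~~ blk_preserving s -> pf_term (cheb_gram n) s = 0.
Proof.
move=> ns; apply: contraNeq ns.
rewrite /pf_term mulf_eq0 signr_eq0 /= => /prodf_neq0 nz.
(* The weights w add up to 0, but each pair with a nonzero entry has weight at
   least 0, and weight 0 only if it lies in a block. *)
pose w (i : 'I_n.*2) : int := if odd i then - (blk i)%:Z else (blk i)%:Z.
have wE b k : w (pos b k) = if b then - k%:Z else k%:Z.
  by rewrite /w odd_pos blk_pos.
have gram0 i j : cheb_gram n i j != 0 ->
    0 <= w i + w j /\ (w i + w j = 0 -> blk i = blk j).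
  rewrite -(pos_odd_blk _ i) -(pos_odd_blk _ j).
  move: (odd i) (blk i) (odd j) (blk j) => b k c l.
  rewrite !wE !blk_pos => nz0.
  (* Triangularity: a nonzero entry pairs an odd position only with an even position of the same or
     a later block. *)
  have eo (k' l' : 'I_n) :
      cheb_gram n (pos false k') (pos true l') != 0 -> (l' <= k')%N.
    rewrite mxE /=; have [// | kl] := leqP l' k'.
    by rewrite skew_form_even_odd ?(ltnW kl) // (ltn_eqF kl) eqxx.
  case: b c nz0 => [] [] nz0.
  - by move: nz0; rewrite mxE skew_form_parity ?eqxx // !odd_pos.
  - have := eo l k; rewrite cheb_gram_skew oppr_eq0 => /(_ nz0) kl.
    by split=> [|e]; [lia | apply: val_inj => /=; lia].
  - have kl := eo k l nz0.
    by split=> [|e]; [lia | apply: val_inj => /=; lia].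
  by move: nz0; rewrite mxE skew_form_parity ?eqxx // !odd_pos.
(* The two positions of a block have opposite weights, and [s] only permutes the positions. *)
have w0 : \sum_i w (s i) = 0.
  transitivity (\sum_i w i); first by rewrite [RHS](reindex_perm s).
  by rewrite big_pos big1 // => k _; rewrite (wE false) (wE true) /= subrr.
rewrite big_pos /= in w0.
apply/forallP => k; apply/eqP.
have wk j : 0 <= w (s (fst_pos j)) + w (s (snd_pos j)).
  by case: (gram0 _ _ (nz j isT)).
apply: (gram0 _ _ (nz k isT)).2.
by apply: (psumr_eq0P (fun j _ => wk j) w0).
Qed.

Theorem theorem2 (n : nat) (hn : (1 <= n)%N) :
  pfaffian (motzkin_matrix n) = \prod_(0 <= k < n) (4 * k + 1)%:R.
Proof.
have skewM i j : motzkin_matrix n j i = - motzkin_matrix n i j.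
  by rewrite !mxE addnC -mulNr opprB.
have := pf_sum_congr _ _ (cheb_matrix n.*2) (motzkin_matrix n).
rewrite -cheb_gramE det_cheb_matrix mul1r (pf_sumE _ _ _ skewM).
rewrite (pf_sum_blk _ _ _ (cheb_gram_skew n) (@pf_term_cheb_gram n)).
(* Both sides carry the same multiplicity, which is nonzero because the identity preserves the
   blocks. *)
move=> /eqP; rewrite eqr_pMn2r; last first.
  apply/card_gt0P; exists 1%g; rewrite inE; apply/forallP => k.
  by rewrite !perm1 (blk_pos _ false) (blk_pos _ true).
move/eqP <-; rewrite big_mkord; apply: eq_bigr => k _.
by rewrite mxE /= skew_form_even_odd ?eqxx.
Qed.
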